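(* Let $m,\ell\ge1$ be integers, set $n=m\ell$, and let $1\le s\le\ell$. The number of $(m+2)$-angulations of the once-punctured polygon $P_n^\bullet$ with exactly $s$ spokes is $m\binom{n+\ell-s-1}{n-1}$.
   Context: $P_n^\bullet$ is a disc with $n$ marked points $v_0,\ldots,v_{n-1}$ on its boundary (in clockwise order, indices mod $n$) and one marked point $\bullet$ (the puncture) in its interior. An arc is a non-self-intersecting curve in the disc whose endpoints are marked points and whose interior avoids the marked points, considered up to isotopy, and not isotopic to a boundary segment or contractible. Two arcs are non-crossing if they have non-crossing representatives in their isotopy classes. A spoke is an arc with an endpoint at $\bullet$. For $m\ge1$, an $(m+2)$-angulation of $P_n^\bullet$ is a set $T$ of pairwise non-crossing arcs such that every connected component of $P_n^\bullet\setminus T$ is an $(m+2)$-gon (sides counted with multiplicity, so e.g. a self-folded triangle counts as a triangle). *)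

(* Defs.v *)
(* Combinatorial model of arcs in the once-punctured
   polygon P_n^bullet, via the universal cover of P_n^bullet minus the
   puncture (an infinite "polygon" with boundary marked points the integers
   and the puncture as a point "at infinity"). *)
From mathcomp Require Import all_boot all_order all_algebra.
From mathcomp Require Import boolp.
Set Implicit Arguments. Unset Strict Implicit. Unset Printing Implicit Defensive.
Import Order.TTheory GRing.Theory Num.Theory.
Local Open Scope ring_scope.

(* Isotopy classes of arcs of P_n^bullet (n >= 1):
   - inl i        : the spoke joining v_i to the puncture;
   - inr (i, k)   : (2 <= k <= n) the arc from v_i to v_{i+k} (indices mod n)
                    such that the component of the complement NOT containing
                    the puncture has boundary marked points v_i, v_{i+1}, ...,
                    v_{i+k} (clockwise).  For k = n this is the loop at v_i
                    enclosing the puncture.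
   Every arc (non-contractible, not isotopic to a boundary segment) is
   isotopic to exactly one of these. *)
Definition parc (n : nat) : finType :=
  ('I_n + {p : 'I_n * 'I_n.+1 | (1 < p.2)%N})%type.

Definition is_spoke n (a : parc n) : bool := if a is inl _ then true else false.

(* Edges of the universal cover: chords [Chord a b] (a < b integers on the
   boundary line) and rays [Ray x] from x to the puncture at infinity. *)
Inductive uedge := Chord of int & int | Ray of int.

Definition lifts n (a : parc n) (e : uedge) : Prop :=
  match a, e with
  | inl i, Ray x => (x %% n)%Z = (i : nat)%:Z
  | inr p, Chord x y => (x %% n)%Z = ((val p).1 : nat)%:Z /\
                        y = x + ((val p).2 : nat)%:Z
  | _, _ => False
  end.

Definition ucross (e f : uedge) : Prop :=
  match e, f with
  | Chord a b, Chord c d => (a < c < b /\ b < d) \/ (c < a < d /\ d < b)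
  | Chord a b, Ray x => a < x < b
  | Ray x, Chord a b => a < x < b
  | Ray _, Ray _ => False
  end.

(* Two arcs cross iff they cannot be isotoped to be disjoint, iff some of
   their lifts cross. *)
Definition crossing n (a b : parc n) : Prop :=
  exists e f, [/\ lifts a e, lifts b f & ucross e f].

Definition noncrossing n (T : {set parc n}) : Prop :=
  forall a b, a \in T -> b \in T -> a != b -> ~ crossing a b.

Definition side n (T : {set parc n}) (x y : int) : Prop :=
  y = x + 1 \/ exists2 a, a \in T & lifts a (Chord x y).

Definition ray n (T : {set parc n}) (x : int) : Prop :=
  exists2 a, a \in T & lifts a (Ray x).

(* A component of the complement of the lift of T not touching the puncture:
   a polygon with corners x_0 < x_1 < ... < x_r (r >= 2) all of whose sides
   are sides of the configuration and with no side of the configuration as a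
   diagonal. *)
Definition bounded_face n (T : {set parc n}) (xs : seq int) : Prop :=
  [/\ sorted <%R xs, (3 <= size xs)%N,
      (forall j, (j.+1 < size xs)%N -> side T (nth 0 xs j) (nth 0 xs j.+1)),
      side T (nth 0 xs 0) (nth 0 xs (size xs).-1) &
      (forall i j, (i.+1 < j)%N -> (j < size xs)%N ->
         ~ (i = 0%N /\ j = (size xs).-1) -> ~ side T (nth 0 xs i) (nth 0 xs j))].

(* A component having the puncture as a corner: corners x_0 < ... < x_r
   (r >= 1) and the puncture, bounded by the rays at x_0 and x_r. *)
Definition punct_face n (T : {set parc n}) (xs : seq int) : Prop :=
  [/\ sorted <%R xs /\ (2 <= size xs)%N,
      ray T (nth 0 xs 0) /\ ray T (nth 0 xs (size xs).-1),
      (forall j, (j.+1 < size xs)%N -> side T (nth 0 xs j) (nth 0 xs j.+1)),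
      (forall j, (0 < j)%N -> (j.+1 < size xs)%N -> ~ ray T (nth 0 xs j)) &
      (forall i j, (i.+1 < j)%N -> (j < size xs)%N -> ~ side T (nth 0 xs i) (nth 0 xs j))].

(* T is an (m+2)-angulation of P_n^bullet: pairwise non-crossing arcs such that
   every component of the complement is an (m+2)-gon (corners counted with
   multiplicity, which in the cover become genuine distinct corners).  The
   puncture must lie on some parc (otherwise the component containing it is
   not a polygon); given that, the components are exactly the faces above. *)
Definition angulation (m n : nat) (T : {set parc n}) : Prop :=
  [/\ noncrossing T,
      exists2 a, a \in T & is_spoke a,
      (forall xs, bounded_face T xs -> size xs = (m + 2)%N) &
      (forall xs, punct_face T xs -> (size xs).+1 = (m + 2)%N)].

Definition nspokes n (T : {set parc n}) : nat := #|[set a in T | is_spoke a]|.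

(* Main.v *)
(* For an (m+2)-angulation T let a_i be the number of non-spoke arcs starting
   at v_i, and let H be the height on the universal cover with
   H (x + 1) = H x + m a_x - 1. Each bounded face forces H to drop by m from
   one arc at x to the next longer one, and each face at the puncture forces
   H to drop by m between consecutive rays. Hence T is recovered from H
   (Lukasiewicz paths): the chords from x end at the first visits of the levels
   H x - 1 + m j with 0 <= j < a_x, and the rays are the record lows of H in a
   fixed residue class c mod m. Conversely every sequence (a_i) of sum l - s and
   every c mod m arise, which gives m * C(n + l - s - 1, n - 1). *)
Require Import Defs.
From mathcomp Require Import all_boot all_order all_algebra.
From mathcomp Require Import boolp.
From mathcomp Require Import zify ring.
Set Implicit Arguments. Unset Strict Implicit. Unset Printing Implicit Defensive.
Import Order.TTheory GRing.Theory Num.Theory.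
Local Open Scope ring_scope.

(** * Divisibility, and cardinals compared through relations *)

Lemma dvdz_addsub (d a b z : int) :
  (d %| a)%Z -> (d %| b)%Z -> z = a - b \/ z = a + b -> (d %| z)%Z.
Proof.
by move=> da db [->|->]; rewrite ?(rpredB da) ?(rpredD da).
Qed.

(** Choice extracts from [Q] a map that is injective on [A]. Relations suit the counts below, where
    an arc is matched with a number through some lift of the arc. *)
Lemma leq_card_rel (T U : finType) (A : {set T}) (B : {set U}) (Q : T -> U -> Prop) :
  (forall x, x \in A -> exists2 y, y \in B & Q x y) ->
  (forall x x' y, x \in A -> x' \in A -> Q x y -> Q x' y -> x = x') ->
  (#|A| <= #|B|)%N.
Proof.
move=> exQ injQ.
have [->|[x0 Ax0]] := set_0Vmem A; first by rewrite cards0.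
have [y0 _ _] := exQ _ Ax0.
have /choice[f fP] : forall x, exists y, x \in A -> y \in B /\ Q x y.
  move=> x; case: (boolP (x \in A)) => [/exQ[y By Qxy]|_]; last by exists y0.
  by exists y.
rewrite -(@card_in_imset _ _ f A).
  by apply/subset_leq_card/subsetP => _ /imsetP[x /fP[By _] ->].
move=> x x' Ax Ax' eqf; apply: (injQ x x' (f x)) => //.
  by have [] := fP x Ax.
by rewrite eqf; have [] := fP x' Ax'.
Qed.

Lemma eq_card_rel (T U : finType) (A : {set T}) (B : {set U}) (Q : T -> U -> Prop) :
  (forall x, x \in A -> exists2 y, y \in B & Q x y) ->
  (forall y, y \in B -> exists2 x, x \in A & Q x y) ->
  (forall x x' y, x \in A -> x' \in A -> Q x y -> Q x' y -> x = x') ->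
  (forall x y y', y \in B -> y' \in B -> Q x y -> Q x y' -> y = y') ->
  #|A| = #|B|.
Proof.
move=> QA QB injA injB; apply/eqP; rewrite eqn_leq (leq_card_rel QA injA) /=.
by apply: (leq_card_rel (Q := fun y x => Q x y)) => // y y' x; apply: injB.
Qed.

(** * Integer paths, unit drops and chords of the cover *)

(** The index is that of the first entry reaching [w]; this locates a point below one side of a
    face. *)
Lemma path_bracket (v w : int) (p : seq int) : v < w -> w <= last v p ->
  exists2 j, (j < size p)%N & nth 0 (v :: p) j < w <= nth 0 p j.
Proof.
elim: p v => [|u p IH] v vw /= wl; first by lia.
have [wu|uw] := leP w u; first by exists 0%N => //=; lia.
by have [j jp jw] := IH u uw wl; exists j.+1.
Qed.

Lemma incr_nth_ge (v : int) (p : seq int) j :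
  (forall i, (i < size p)%N -> nth 0 (v :: p) i < nth 0 p i) ->
  (j <= size p)%N -> v <= nth 0 (v :: p) j.
Proof.
move=> incr; elim: j => [|j IHj] jp /=; first by lia.
exact: le_trans (IHj (ltnW jp)) (ltW (incr j jp)).
Qed.

(* The steps to the longest chord (or edge) leaving each corner turn out to be
   unit drops of the height; their concatenations bound faces. *)
Definition unit_drop (H : int -> int) (u v : int) : bool :=
  `[< [/\ u < v, H v = H u - 1 & forall z : int, u < z < v -> H v < H z] >].

(** First visits concatenate: the end of the path is the first visit, from [x] on, of the level
    [size p] below [H x]. *)
Lemma unit_drop_path (H : int -> int) (x : int) (p : seq int) : path (unit_drop H) x p ->
  [/\ H (last x p) = H x - (size p)%:Z, x <= last x p &
      forall z : int, x <= z < last x p -> H (last x p) < H z].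
Proof.
elim: p x => [|v p IH] x /=; first by move=> _; split=> //; [lia|move=> z; lia].
move=> /andP[/asboolP[xv Hv Hz] /IH[Hl vl Hl']]; split; [lia|lia|move=> z xz].
have [zv|vz] := leP v z; first by apply: Hl'; lia.
have [->|nzx] := eqVneq z x; first by lia.
by have := Hz z; lia.
Qed.

Definition chord n (T : {set parc n}) (x y : int) : Prop :=
  exists2 a, a \in T & lifts a (Chord x y).

(** An arc has exactly one lift starting at each lift of its first endpoint, so this is the number
    a_x of non-spoke arcs at the vertex below [x]. *)
Definition outdeg n (T : {set parc n}) (x : int) : nat :=
  #|[set k : 'I_n.+1 | `[< chord T x (x + (k : nat)%:Z) >]]|.

Lemma chord_len n (T : {set parc n}) x y : chord T x y -> x + 1 < y <= x + n%:Z.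
Proof.
move=> [[//|[[i k] /= k1]] _ /= [_ ->]]; have := ltn_ord k; lia.
Qed.

(** Modulo [m] a height is minus its position, so congruences pass between heights and positions. *)
Lemma dvd_height (m : nat) (H : int -> int) : (forall x : int, (m %| H x + x)%Z) ->
  forall x y : int, (m %| H x - H y)%Z = (m %| y - x)%Z.
Proof.
move=> Hmod x y; have h := dvdz_addsub (Hmod y) (Hmod x) (or_introl erefl).
apply/idP/idP => d; first by apply: (dvdz_addsub h d); right; lia.
by apply: (dvdz_addsub d h); left; lia.
Qed.

(** * From a height function to an angulation *)

Section Profile.
Variables (m n s : nat) (H : int -> int).
Hypotheses (m_gt0 : (0 < m)%N) (n_gt0 : (0 < n)%N) (s_gt0 : (0 < s)%N).
Hypothesis m_dvd_n : (m %| n)%N.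
Hypothesis Hstep : forall x : int, H x - 1 <= H (x + 1).
Hypothesis Hmod : forall x : int, (m %| H x + x)%Z.
Hypothesis Hper : forall x : int, H (x + n%:Z) = H x - (m * s)%N%:Z.

(** Under [Hmod] the divisibility says that [H y = H x - 1 + m j] for some integer [j], nonnegative
    by the second clause: [y] is the first visit of such a level after [x]. Boundary edges are
    included, as in [side]. *)
Definition height_chord (x y : int) : Prop :=
  [/\ x < y, H x - 1 <= H y, (m %| y - x - 1)%Z & forall z : int, x < z < y -> H y < H z].

Definition record_low (x : int) : Prop := forall z : int, z < x -> H x < H z.

Lemma height_ge_sub (x : int) (d : nat) : H x - d%:Z <= H (x + d%:Z).
Proof.
elim: d => [|d IH]; first by rewrite subr0 addr0.
have := Hstep (x + d%:Z); have -> : x + d.+1%:Z = x + d%:Z + 1 by lia.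
lia.
Qed.

Lemma height_shift_nat (x : int) (k : nat) : H (x + k%:Z * n%:Z) = H x - k%:Z * (m * s)%N%:Z.
Proof.
elim: k => [|k IH]; first by rewrite !mul0r addr0 subr0.
have -> : x + k.+1%:Z * n%:Z = x + k%:Z * n%:Z + n%:Z by lia.
by rewrite Hper IH; lia.
Qed.

Lemma height_shift (x : int) (q : int) : H (x + q * n%:Z) = H x - q * (m * s)%N%:Z.
Proof.
case: q => [k|k]; first exact: height_shift_nat.
rewrite NegzE; have := height_shift_nat (x + - k.+1%:Z * n%:Z) k.+1.
rewrite (_ : _ + k.+1%:Z * n%:Z = x); last by ring.
by move=> ->; ring.
Qed.

Lemma ms_gt0 : (0 < m * s)%N. Proof. by rewrite muln_gt0 m_gt0. Qed.

(** [H] tends to minus infinity on the right by [Hper], and skips no level on the way down because a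
    step lowers it by at most 1. *)
Lemma first_hit (x v : int) : v < H x ->
  exists y, [/\ x < y, H y = v & forall z : int, x <= z < y -> v < H z].
Proof.
move=> vx; have ms0 := ms_gt0.
have ex : exists d : nat, H (x + d%:Z) <= v.
  have [D eD] : exists D : nat, H x - v = D%:Z by exists `|H x - v|%N; lia.
  (* Each period lowers [H] by [m * s], hence by at least 1, so [D] periods suffice. *)
  by exists (D * n)%N; rewrite PoszM height_shift_nat; move: (m * s)%N ms0 => P ms0; nia.
have ex' : exists d : nat, `[< H (x + d%:Z) <= v >].
  by have [d] := ex; exists d; apply/asboolP.
case: (ex_minnP ex') => d /asboolP Hd dmin; exists (x + d%:Z).
have hz z : x <= z < x + d%:Z -> v < H z.
  move=> xz; rewrite ltNge; apply/negP => Hz.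
  have := dmin `|z - x|%N; rewrite (_ : x + _ = z); last by lia.
  by move=> /(_ (asboolT Hz)); lia.
case: d Hd {dmin} hz => [|d] Hd hz; first by rewrite addr0 in Hd; lia.
split=> //; first by lia.
have := hz (x + d%:Z); have := Hstep (x + d%:Z).
rewrite (_ : x + d%:Z + 1 = x + d.+1%:Z); lia.
Qed.

(** A first visit of [v] is a record low when it is sought from a point to the left of which [H]
    stays above [v]. *)
Lemma record_low_hit (v : int) : exists2 y, H y = v & record_low y.
Proof.
have ms0 := ms_gt0.
(* A period to the left gains at least 1, and the remainder modulo [n] costs less than [n] relative
   to [H 0]. *)
pose K := (absz (v - H 0 + n%:Z)).+1.
have far z : z < - (K%:Z * n%:Z) -> v < H z.
  move=> zK; rewrite (divz_eq z n%:Z); set q := (z %/ n)%Z; set r := (z %% n)%Z.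
  have r0 : 0 <= r by apply: modz_ge0; lia.
  have rn : r < n%:Z by apply: ltz_pmod; lia.
  rewrite addrC height_shift; have := height_ge_sub 0 `|r|; rewrite add0r; move: (m * s)%N ms0 => P ms0.
  have -> : `|r|%N%:Z = r by lia.
  have qK : q < - K%:Z + 1.
    rewrite ltNge; apply/negP => qK; have := divz_eq z n%:Z; rewrite -/q -/r; nia.
  nia.
have [|y [xy Hy hz]] := @first_hit (- (K%:Z * n%:Z) - 1) v; first by apply: far; lia.
exists y => // z zy; rewrite Hy.
have [|] := leP (- (K%:Z * n%:Z) - 1) z; first by move=> h; apply: hz; lia.
by move=> h; apply: far; lia.
Qed.

Lemma height_chord1 (x : int) : height_chord x (x + 1).
Proof.
split; [by lia|by apply: Hstep| |by move=> z; lia].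
by rewrite (_ : _ - 1 = 0) ?dvdz0 //; lia.
Qed.

(** A longer chord would pass over [x + n], where the height is already at most [H x - 1]. Thus
    these chords are short enough to be lifts of arcs. *)
Lemma height_chord_len (x y : int) : height_chord x y -> y <= x + n%:Z.
Proof.
move=> [xy Hy _ Hz]; rewrite leNgt; apply/negP => ny.
by have := Hz (x + n%:Z); rewrite Hper; have := ms_gt0; lia.
Qed.

Lemma height_chord_shift (x y q : int) : height_chord x y -> height_chord (x + q * n%:Z) (y + q * n%:Z).
Proof.
move=> [xy Hy d Hz]; split; [by lia|by rewrite !height_shift; lia| |].
  by rewrite (_ : _ - 1 = y - x - 1) //; lia.
move=> z zz; have := Hz (z - q * n%:Z).
have := height_shift (z - q * n%:Z) q; rewrite subrK => ->.
rewrite height_shift; lia.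
Qed.

Lemma record_low_shift (x q : int) : record_low x -> record_low (x + q * n%:Z).
Proof.
move=> lx z zx; have := lx (z - q * n%:Z).
have := height_shift (z - q * n%:Z) q; rewrite subrK => ->.
rewrite height_shift; lia.
Qed.

(** A crossing gives [H d < H b < H c], which contradicts [H c - 1 <= H d]. *)
Lemma height_chord_nocross (a b c d : int) : height_chord a b -> height_chord c d -> ~ (a < c < b /\ b < d).
Proof.
move=> [ab Ha _ Hab] [cd Hc _ Hcd] [h1 h2].
by have := Hab c h1; have := Hcd b; lia.
Qed.

Lemma height_chord_no_record_low (a b x : int) : height_chord a b -> record_low x -> ~ a < x < b.
Proof. by move=> [ab Ha _ Hab] lx h; have := Hab x h; have := lx a; lia. Qed.

Lemma height_chord_dvd (x y : int) : height_chord x y -> (m %| H y - H x + 1)%Z.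
Proof.
move=> [_ _ d _]; have h : (m %| H y + y - (H x + x))%Z by apply: rpredB.
by apply: (dvdz_addsub h d); left; lia.
Qed.

(* If the height rose along a side x -> v, the first return to level H v - m
   after v would end another chord from x, hence a diagonal of the face. *)
Lemma face_unit_drop (x : int) (p : seq int) :
  (forall j, (j < size p)%N -> height_chord (nth 0 (x :: p) j) (nth 0 p j)) ->
  (forall z : int, x <= z < last x p -> H (last x p) < H z) ->
  (forall i j, (i.+1 < j)%N -> (j <= size p)%N ->
     ~ height_chord (nth 0 (x :: p) i) (nth 0 (x :: p) j)) ->
  path (unit_drop H) x p.
Proof.
elim: p x => [//|v p IH] x sides hl diag.
have incr j : (j < size p)%N -> nth 0 (v :: p) j < nth 0 p j.
  by move=> jp; have [] := sides j.+1 jp.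
have last_ge : v <= last v p by rewrite (last_nth 0); apply: incr_nth_ge.
have xv := sides 0%N isT; rewrite /= in xv hl.
have [/= xltv Hv dv Hz] := xv.
rewrite /=; apply/andP; split; last first.
  apply: IH => [j jp|z vz|i j ij jp]; first exact: (sides j.+1).
    by case/andP: vz => vz zl; apply: hl; rewrite zl (le_trans (ltW xltv) vz).
  exact: (diag i.+1 j.+1).
apply/asboolP; split=> //; apply/eqP; rewrite eq_le Hv andbT leNgt; apply/negP => Hv1.
have /dvdzP[k ek] := height_chord_dvd xv.
have k1 : 1 <= k by nia.
have [|w [vw Hw hw]] := @first_hit v (H v - m%:Z); first by lia.
have Hlx := hl x ltac:(lia).
(* Before [w] the height exceeds [H v - m], which is at least [H x - 1], whereas the last corner is
   lower than [x]. *)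
have wl : w <= last v p.
  by rewrite leNgt; apply/negP => lw; have := hw (last v p); nia.
have xw : height_chord x w.
  split; [lia|nia| |move=> z zz].
    have mvw : (m %| w - v)%Z by rewrite -(dvd_height Hmod) Hw (_ : _ - _ = m%:Z) ?dvdzz; lia.
    by apply: (dvdz_addsub dv mvw); right; lia.
  rewrite Hw; have [vz|zv] := leP v z; first by apply: hw; lia.
  by have := Hz z; lia.
(* Either [w] is a corner, and the chord from [x] to [w] is a diagonal, or [w] is strictly below a
   side, which that chord crosses. *)
have [j jp jw] := path_bracket vw wl.
have [wj|wj] := ltP w (nth 0 p j); last first.
  have e : w = nth 0 p j by apply/eqP; rewrite eq_le; lia.
  by apply: (diag 0%N j.+2) => //=; rewrite -e.
have cj : height_chord (nth 0 (v :: p) j) (nth 0 p j) by apply: (sides j.+1).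
have vj : v <= nth 0 (v :: p) j by apply: incr_nth_ge (ltnW jp).
by apply: (height_chord_nocross xw cj); case/andP: jw => jw _; rewrite jw wj (lt_le_trans xltv vj).
Qed.

Definition height_arcs (c : nat) : {set parc n} :=
  [set a : parc n | match a with
    | inl i => `[< record_low (i : nat)%:Z /\ (m %| (i : nat)%:Z - c%:Z)%Z >]
    | inr p => `[< height_chord ((val p).1 : nat)%:Z
                          (((val p).1 : nat)%:Z + ((val p).2 : nat)%:Z) >]
    end].

Lemma ord_modz (x : int) : exists i : 'I_n, (x %% n)%Z = (i : nat)%:Z.
Proof.
have r0 : 0 <= (x %% n)%Z by apply: modz_ge0; lia.
have rn : (x %% n)%Z < n%:Z by apply: ltz_pmod; lia.
have lt : (`|(x %% n)%Z| < n)%N by lia.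
by exists (Ordinal lt) => /=; lia.
Qed.

Lemma side_height_arcs (c : nat) (x y : int) : side (height_arcs c) x y <-> height_chord x y.
Proof.
split.
  move=> [->|[[i|p] + //]]; first exact: height_chord1.
  rewrite inE => /asboolP + [hx ->] => ch.
  rewrite (divz_eq x n%:Z) hx (addrC (_ * _)) -addrA (addrC (_ * _)) addrA.
  exact: height_chord_shift.
move=> ch; have [->|nxy] := eqVneq y (x + 1); [by left|right].
have [xy _ _ _] := ch; have len := height_chord_len ch.
have [i ei] := ord_modz x.
have kn : (`|y - x| < n.+1)%N by lia.
have k1 : (1 < (i, Ordinal kn).2)%N by move: nxy => /=; lia.
exists (inr (exist _ (i, Ordinal kn) k1)); last by rewrite /=; split=> //; lia.
rewrite inE; apply/asboolP => /=.
have := height_chord_shift (- (x %/ n)%Z) ch.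
rewrite -ei; have e := divz_eq x n%:Z.
rewrite (_ : x + _ = (x %% n)%Z); last by lia.
by rewrite (_ : y + _ = (x %% n)%Z + `|y - x|%N%:Z) //; lia.
Qed.

Lemma ray_height_arcs (c : nat) (x : int) : ray (height_arcs c) x <-> record_low x /\ (m %| x - c%:Z)%Z.
Proof.
have e := divz_eq x n%:Z.
have mq (q : int) : (m %| q * n)%Z by rewrite dvdz_mull.
split.
  move=> [[i|p] // + hx]; rewrite inE => /asboolP[li di].
  rewrite /= in hx; rewrite hx in e; rewrite e addrC; split; first exact: record_low_shift.
  by apply: (dvdz_addsub di (mq (x %/ n)%Z)); right; lia.
move=> [lx dx]; have [i ei] := ord_modz x.
exists (inl i) => //; rewrite inE; apply/asboolP.
have := @record_low_shift x (- (x %/ n)%Z) lx.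
rewrite -ei (_ : x + _ = (x %% n)%Z); last by lia.
by move=> ?; split=> //; apply: (dvdz_addsub dx (mq (x %/ n)%Z)); left; lia.
Qed.

Lemma noncrossing_height_arcs c : noncrossing (height_arcs c).
Proof.
have chord a x y : a \in height_arcs c -> lifts a (Chord x y) -> height_chord x y.
  by move=> aT la; apply/(side_height_arcs c); right; exists a.
have ray' a x : a \in height_arcs c -> lifts a (Ray x) -> record_low x.
  by move=> aT la; have [] : record_low x /\ (m %| x - c%:Z)%Z by apply/ray_height_arcs; exists a.
move=> a b aT bT _ [[x y|x] [[z w|z] [la lb]]] //=.
- move=> [h|h]; first exact: height_chord_nocross (chord _ _ _ aT la) (chord _ _ _ bT lb) h.
  exact: height_chord_nocross (chord _ _ _ bT lb) (chord _ _ _ aT la) h.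
- exact: height_chord_no_record_low (chord _ _ _ aT la) (ray' _ _ bT lb).
- exact: height_chord_no_record_low (chord _ _ _ bT lb) (ray' _ _ aT la).
Qed.

(** Unit drops make [size p] the total height loss, a multiple of [m]. If it is not [m], the corner
    [w] that lies [m] levels below [x] comes before the end; it will carry a forbidden diagonal or
    ray. *)
Lemma face_size (x : int) (p : seq int) :
  (forall j, (j < size p)%N -> height_chord (nth 0 (x :: p) j) (nth 0 p j)) ->
  (forall z : int, x <= z < last x p -> H (last x p) < H z) ->
  (forall i j, (i.+1 < j)%N -> (j <= size p)%N ->
     ~ height_chord (nth 0 (x :: p) i) (nth 0 (x :: p) j)) ->
  (0 < size p)%N -> (m %| last x p - x)%Z -> size p != m ->
  exists2 w : int, nth 0 p m.-1 = w &
    [/\ (m < size p)%N, x < w, H w = H x - m%:Z, H (last x p) <= H w &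
        forall z : int, x <= z < w -> H w < H z].
Proof.
move=> sides hl diag p0 d nm; have dp := face_unit_drop sides hl diag.
have [Hl _ _] := unit_drop_path dp.
have mp : (m %| size p)%N.
  have : (m %| H x - H (last x p))%Z by rewrite (dvd_height Hmod).
  by rewrite Hl subKr.
have mlt : (m < size p)%N by rewrite ltn_neqAle eq_sym nm dvdn_leq.
have w : nth 0 p m.-1 = last x (take m p).
  by rewrite -nth_last size_take mlt nth_take ?prednK // (set_nth_default 0) // prednK // ltnW.
have dt : path (unit_drop H) x (take m p).
  by move: dp; rewrite -{1}(cat_take_drop m p) cat_path => /andP[].
have [Hw xw hw] := unit_drop_path dt.
exists (last x (take m p)) => //; move: Hw; rewrite size_take mlt => Hw; split=> //; last by rewrite Hl Hw; lia.
rewrite lt_neqAle xw andbT; apply/eqP => e; move: Hw; rewrite -e; lia.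
Qed.

Lemma angulation_height_arcs c : angulation m (height_arcs c).
Proof.
split; first exact: noncrossing_height_arcs.
(* By [Hmod] a point at level [- c] has position congruent to [c], so the record low there is a
   ray. *)
- have [y Hy ly] := record_low_hit (- c%:Z).
  have [[i|//] ai _] : ray (height_arcs c) y.
    apply/ray_height_arcs; split=> //; have := Hmod y; rewrite Hy.
    by rewrite addrC.
  by exists (inl i).
- move=> [|x0 [|x1 p]] [] // _ p0 sides top diag; rewrite /= in p0.
  move: top; rewrite nth_last /= => /side_height_arcs[x0l Hl dl hl].
  have sides' j : (j < (size p).+1)%N -> height_chord (nth 0 (x0 :: x1 :: p) j) (nth 0 (x1 :: p) j).
    by move=> jp; apply/(side_height_arcs c); apply: (sides j).
  have [/= x01 H1 d1 h1] := sides' 0%N isT.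
  apply/eqP; rewrite /= addn2 !eqSS; apply: contraT => nm.
  have [|||||w ew [mlt xw Hw Hlw hw]] := @face_size x1 p _ _ _ _ _ nm; rewrite /= in p0 *.
  + by move=> j jp; apply: (sides' j.+1).
  + by move=> z zz; apply: hl; case/andP: zz => x1z ->; rewrite (lt_le_trans x01 x1z).
  + move=> i j ij jp /(side_height_arcs c) ch; apply: (diag i.+1 j.+1) => //=; lia.
  + by [].
  + by apply: (dvdz_addsub dl d1); left; lia.
  (* In the whole face [w] has index [m + 1]. It is [m] levels below [x1] but not below the last
     corner, so [x0] and [w] span a chord. *)
  exfalso; apply: (diag 0%N m.+1) => //=; [lia|lia|].
  rewrite -[m in nth _ _ m](prednK m_gt0) /= ew; apply/side_height_arcs; split.
  + exact: lt_trans xw.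
  + exact: le_trans Hlw.
  + have dw : (m %| w - x1)%Z by rewrite -(dvd_height Hmod) Hw (_ : _ - _ = m%:Z) ?dvdzz; lia.
    by apply: (dvdz_addsub d1 dw); right; lia.
  + move=> z /andP[xz zw]; have [x1z|zx1] := leP x1 z; first by apply: hw; rewrite x1z.
    by have := h1 z; rewrite xz zx1 => /(_ isT); rewrite Hw; lia.
- move=> [|x0 p] [] [_ p0] // [r0 rl] sides nray diag; rewrite /= in p0 *.
  move: rl r0; rewrite nth_last => /ray_height_arcs[/= ll dl] /ray_height_arcs[/= l0 d0].
  apply/eqP; rewrite addn2 !eqSS; apply: contraT => nm.
  have [|||||w ew [mlt xw Hw Hlw hw]] := @face_size x0 p _ _ _ _ _ nm.
  + by move=> j jp; apply/(side_height_arcs c); apply: (sides j).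
  + by move=> z /andP[_]; apply: ll.
  + by move=> i j ij jp /(side_height_arcs c); apply: diag.
  + by [].
  + by apply: (dvdz_addsub dl d0); left; lia.
  (* Here [w] has index [m]; it is a record low because [x0] is one, and its residue is that of
     [x0], so a ray enters the face. *)
  exfalso; apply: (nray m) => //=.
  rewrite -[m in nth _ _ m](prednK m_gt0) /= ew; apply/ray_height_arcs; split.
  + move=> z zw; have [xz|zx] := leP x0 z; first by apply: hw; rewrite xz.
    by have := l0 z zx; rewrite Hw; lia.
  + have dw : (m %| w - x0)%Z by rewrite -(dvd_height Hmod) Hw (_ : _ - _ = m%:Z) ?dvdzz; lia.
    by apply: (dvdz_addsub d0 dw); right; lia.
Qed.

Lemma record_low_inj (x y : int) : record_low x -> record_low y -> H x = H y -> x = y.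
Proof.
move=> lx ly e; have [xy|yx|//] := ltgtP x y.
  by have := ly x xy; lia.
by have := lx y yx; lia.
Qed.

(** Rays are the record lows at the levels congruent to [- c] modulo [m], one per level. A period
    shifts levels by [m * s], which leaves [s] classes, indexed by [q]. *)
Lemma nspokes_height_arcs c : nspokes (height_arcs c) = s.
Proof.
rewrite /nspokes -[RHS]card_ord -cardsT.
pose Q (a : parc n) (q : 'I_s) := exists x : int,
  [/\ lifts a (Ray x), record_low x & H x = - c%:Z - m%:Z * (q : nat)%:Z].
apply: (eq_card_rel (Q := Q)).
- move=> a; rewrite inE => /andP[+ sa]; case: a sa => [i|//] _; rewrite inE => /asboolP[li di].
  have /dvdzP[k ek] : (m %| H (i : nat)%:Z + c%:Z)%Z.
    by apply: (dvdz_addsub (Hmod (i : nat)%:Z) di); left; lia.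
  have q0 : 0 <= (- k %% s)%Z by apply: modz_ge0; lia.
  have qs : (- k %% s)%Z < s%:Z by apply: ltz_pmod; lia.
  have lt : (`|(- k %% s)%Z| < s)%N by lia.
  (* The spoke has level [- c + m k]; this shift replaces [- k] by its remainder modulo [s]. *)
  exists (Ordinal lt) => //; exists ((i : nat)%:Z + - (- k %/ s)%Z * n%:Z); split.
  + by rewrite /= addrC modzMDl modz_small //; have := ltn_ord i; lia.
  + exact: record_low_shift.
  rewrite height_shift /=; have e := divz_eq (- k) s.
  have -> : `|(- k %% s)%Z|%N%:Z = (- k %% s)%Z by lia.
  have -> : (- k %% s)%Z = - k - (- k %/ s)%Z * s%:Z by lia.
  rewrite PoszM; apply: (addIr c%:Z); rewrite addrAC ek; ring.
- move=> q _; have [y Hy ly] := record_low_hit (- c%:Z - m%:Z * (q : nat)%:Z).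
  have [[i|//] aT la] : ray (height_arcs c) y.
    apply/ray_height_arcs; split=> //; have := Hmod y; rewrite Hy => d.
    have dq : (m %| m%:Z * (q : nat)%:Z)%Z by rewrite dvdz_mulr.
    by apply: (dvdz_addsub d dq); right; lia.
  by exists (inl i); [rewrite inE; apply/andP|exists y].
- move=> a a' q _ _; case: a => [i|p]; last by move=> [x []].
  case: a' => [i'|p]; last by move=> _ [x []].
  move=> [x [hx lx Hx]] [x' [hx' lx' Hx']].
  have e : x = x' by apply: record_low_inj; rewrite // Hx Hx'.
  by congr inl; apply: val_inj; move: hx hx'; rewrite /= e => -> [].
- move=> a q q' _ _ [x [hx _ Hx]] [x' [hx' _ Hx']].
  case: a hx hx' => [i|//] /= hx hx'; apply: val_inj => /=.
  have ex := divz_eq x n; have ex' := divz_eq x' n; rewrite hx in ex; rewrite hx' in ex'.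
  set y := (x' %/ n)%Z in ex'; set y0 := (x %/ n)%Z in ex.
  have e := height_shift x (y - y0).
  have exx : x + (y - y0) * n%:Z = x' by rewrite ex' ex; ring.
  rewrite exx Hx Hx' PoszM in e.
  have {e}: m%:Z * ((q' : nat)%:Z - (q : nat)%:Z) = m%:Z * ((y - y0) * s%:Z).
    apply: (addrI (- c%:Z - m%:Z * (q' : nat)%:Z)); rewrite {2}e; ring.
  move/mulfI => /(_ ltac:(lia)); have := ltn_ord q; have := ltn_ord q'.
  move: (y - y0) => u q's qs e; have u0 : u = 0 by have [||//] := ltgtP u 0; nia.
  by rewrite u0 mul0r in e; lia.
Qed.

(** The levels [H x - 1 + m j] with [0 <= j < d] are those lying below [H (x + 1)], and each has a
    single first visit after [x + 1]. *)
Lemma outdeg_height_arcs c (x : int) (d : nat) :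
  H (x + 1) = H x + (m * d)%N%:Z - 1 -> outdeg (height_arcs c) x = d.
Proof.
move=> Hx1; rewrite /outdeg -[RHS]card_ord -cardsT.
have chP y : chord (height_arcs c) x y <-> x + 1 < y /\ height_chord x y.
  split=> [ch|[xy]].
    have := chord_len ch; split; first by lia.
    by apply/(side_height_arcs c); right.
  by move=> /(side_height_arcs c)[e|//]; lia.
pose Q (k : 'I_n.+1) (j : 'I_d) := H (x + (k : nat)%:Z) = H x - 1 + m%:Z * (j : nat)%:Z.
apply: (eq_card_rel (Q := Q)).
- move=> k; rewrite inE => /asboolP/chP[k1 ch].
  have /dvdzP[q eq] := height_chord_dvd ch; have [_ hk _ hz] := ch.
  have hx1 := hz (x + 1) ltac:(lia).
  have q0 : 0 <= q by nia.
  have qd : q < d%:Z by nia.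
  have lt : (`|q| < d)%N by lia.
  exists (Ordinal lt) => //; rewrite /Q /=.
  have -> : `|q|%N%:Z = q by lia.
  by rewrite mulrC -eq; ring.
- move=> j _; have jd := ltn_ord j.
  have [|y [xy Hy hy]] := @first_hit (x + 1) (H x - 1 + m%:Z * (j : nat)%:Z).
    by rewrite Hx1; nia.
  have ch : height_chord x y.
    split; [lia|by rewrite Hy; nia| |].
      have d1 : (m %| H y - H x + 1)%Z.
        by rewrite Hy (_ : _ + 1 = m%:Z * (j : nat)%:Z) ?dvdz_mulr //; ring.
      have d2 := dvdz_addsub (Hmod y) (Hmod x) (or_introl erefl).
      by apply: (dvdz_addsub d2 d1); left; lia.
    by move=> z xz; rewrite Hy; apply: hy; lia.
  have len := height_chord_len ch.
  have kn : (`|y - x| < n.+1)%N by lia.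
  have e : x + `|y - x|%N%:Z = y by lia.
  exists (Ordinal kn); last by rewrite /Q /= e.
  by rewrite inE; apply/asboolP/chP; rewrite /= e.
- move=> k k' j; rewrite !inE => /asboolP/chP[k1 [_ _ _ h]] /asboolP/chP[k1' [_ _ _ h']].
  rewrite /Q => e e'; apply: val_inj => /=; have [kk|kk|//] := ltngtP k k'.
    by have := h' (x + (k : nat)%:Z); lia.
  by have := h (x + (k' : nat)%:Z); lia.
- move=> k j j' _ _; rewrite /Q => -> e; apply: val_inj => /=; nia.
Qed.

End Profile.

(** * Greedy paths, which trace the corners of faces *)

(** The bound [y] is the last corner of the face being traced; maximality of each step is what
    excludes diagonals. *)
Definition greedy (S : int -> int -> Prop) (y u v : int) : bool :=
  `[< [/\ u < v, v <= y, S u v & forall w : int, v < w <= y -> ~ S u w] >].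

Section Greedy.
Variable S : int -> int -> Prop.
Hypothesis S1 : forall u : int, S u (u + 1).

Lemma greedy_step (x y : int) : x < y -> exists v, greedy S y x v.
Proof.
move=> xy; pose P (d : nat) := [&& (0 < d)%N, x + d%:Z <= y & `[< S x (x + d%:Z) >]].
have exP : exists d, P d.
  by exists 1%N; rewrite /P /=; apply/andP; split; [lia|apply/asboolP].
have Pmax d : P d -> (d <= `|y - x|)%N by move=> /and3P[_ h _]; lia.
case: (ex_maxnP exP Pmax) => d /and3P[d0 dy /asboolP Sd] dmax.
exists (x + d%:Z); apply/asboolP; split=> //; first by lia.
move=> w /andP[dw wy] Sw; have e : w = x + `|w - x|%N%:Z by lia.
have := dmax `|w - x|%N; rewrite /P -e wy asboolT //; lia.
Qed.

Lemma greedy_path (x y : int) : x <= y -> exists2 p, path (greedy S y) x p & last x p = y.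
Proof.
move: {2}`|y - x|%N (leqnn `|y - x|%N) => d; elim: d x => [|d IH] x dx xy.
  by exists [::] => //=; lia.
have [->|nxy] := eqVneq x y; first by exists [::].
have [v gv] : exists v, greedy S y x v by apply: greedy_step; lia.
have /asboolP[xv vy _ _] := gv.
by have [||p pp lp] := IH v; [lia|lia|exists (v :: p) => //=; rewrite gv].
Qed.

Lemma greedy_range (x y : int) p j :
  path (greedy S y) x p -> (j < size p)%N -> x < nth 0 p j <= y.
Proof.
elim: p x j => [|v p IH] x [|j] //= /andP[/asboolP[xv vy _ _] pp] jp.
  by rewrite xv vy.
by have /andP[h ->] := IH v j pp jp; rewrite (lt_trans xv h).
Qed.

Lemma greedy_inner (x y : int) p j : path (greedy S y) x p -> last x p = y ->
  (j.+1 < size p)%N -> x < nth 0 p j < y.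
Proof.
elim: p x j => [|v p IH] x [|j] //= /andP[/asboolP[xv vy _ _] pp] lp jp.
  rewrite xv /=; have /andP[vw wy] := greedy_range pp (jp : (0 < size p)%N).
  exact: lt_le_trans vw wy.
by have /andP[h ->] := IH v j pp lp jp; rewrite (lt_trans xv h).
Qed.

(** All later corners are at most [y], so a diagonal would have been a longer admissible step. *)
Lemma greedy_nodiag (x y : int) p i j : path (greedy S y) x p ->
  (i.+1 < j)%N -> (j <= size p)%N -> ~ S (nth 0 (x :: p) i) (nth 0 (x :: p) j).
Proof.
elim: p x i j => [|v p IH] x [|i] [|[|j]] //= /andP[/asboolP[xv vy _ gv] pp] ij jp.
  by apply: gv; apply: greedy_range.
exact: (IH v i j.+1).
Qed.

Lemma greedy_sorted (x y : int) p : path (greedy S y) x p -> path <%R x p.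
Proof. by apply: sub_path => u v /asboolP[]. Qed.

Lemma greedy_sides (x y : int) p j : path (greedy S y) x p ->
  (j < size p)%N -> S (nth 0 (x :: p) j) (nth 0 p j).
Proof. by move=> /(pathP 0) h /h /asboolP[]. Qed.

End Greedy.

(** * From an angulation to its height function *)

Lemma ray_shift n (T : {set parc n}) (x q : int) : ray T x -> ray T (x + q * n%:Z).
Proof.
by move=> [[i|//] aT hx]; exists (inl i) => //; rewrite /= addrC modzMDl.
Qed.

Lemma chord_shift n (T : {set parc n}) (x y q : int) :
  chord T x y -> chord T (x + q * n%:Z) (y + q * n%:Z).
Proof.
move=> [[//|p] aT /= [hx ->]]; exists (inr p) => //=.
by split; [rewrite addrC modzMDl|rewrite addrAC].
Qed.

Lemma eq_parc_set n (T T' : {set parc n}) : (0 < n)%N ->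
  (forall x : int, ray T x <-> ray T' x) ->
  (forall x y : int, chord T x y <-> chord T' x y) -> T = T'.
Proof.
move=> n0 rr cc.
have liftI (i : 'I_n) : ((i : nat)%:Z %% n)%Z = (i : nat)%:Z.
  by rewrite modz_small //; have := ltn_ord i; lia.
have rayP (U : {set parc n}) (i : 'I_n) : inl i \in U <-> ray U (i : nat)%:Z.
  split=> [iU|[[j|//] jU /=]]; first by exists (inl i); rewrite //= liftI.
  by rewrite liftI => -[e]; rewrite (_ : i = j) //; apply: val_inj.
have chordP (U : {set parc n}) p :
    inr p \in U <-> chord U ((val p).1 : nat)%:Z (((val p).1 : nat)%:Z + ((val p).2 : nat)%:Z).
  split=> [pU|[[//|q] qU /=]]; first by exists (inr p); rewrite //= liftI.
  rewrite liftI => -[[e1] e2]; rewrite (_ : p = q) //; apply: val_inj.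
  case: p q e1 e2 {qU} => -[i k] /= _ [[i' k'] /= _] /= e1 e2.
  by congr (_, _); apply: val_inj => /=; lia.
apply/setP => -[i|p]; apply/idP/idP.
- by move=> /rayP/rr/rayP.
- by move=> /rayP/rr/rayP.
- by move=> /chordP/cc/chordP.
- by move=> /chordP/cc/chordP.
Qed.

Section Angulation.
Variables (m n : nat) (T : {set parc n}) (H : int -> int).
Hypotheses (m_gt0 : (0 < m)%N) (n_gt0 : (0 < n)%N).
Hypothesis angT : angulation m T.
Hypothesis Hdeg : forall x : int, H (x + 1) = H x + (m * outdeg T x)%N%:Z - 1.

(** [noncrossing] compares distinct arcs only. Two lifts of one arc are translates by a multiple of
    [n], and their length is at most [n], so they do not cross either. *)
Lemma lifts_nocross a b e f :
  a \in T -> b \in T -> lifts a e -> lifts b f -> ~ ucross e f.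
Proof.
move=> aT bT la lb; have [nc _ _ _] := angT.
have [eab|ab] := eqVneq a b; last by move=> h; apply: (nc a b) => //; exists e, f.
move: la lb; rewrite -eab {b bT eab}.
case: a aT => [i|[[i k] k1]] _; case: e => [x y|x]; case: f => [z w|z] //=; first by move=> _ _ [].
have kn := ltn_ord k.
move=> [hx ->] [hz ->]; have := divz_eq x n; have := divz_eq z n; rewrite hx hz.
move: (x %/ n)%Z (z %/ n)%Z => u v ez ex h.
have e : z - x = (v - u) * n%:Z by rewrite ez ex; ring.
have [vu|vu|vu] := ltgtP v u; nia.
Qed.

Lemma chord_nocross (x y z w : int) : chord T x y -> chord T z w -> ~ (x < z < y /\ y < w).
Proof. by move=> [a aT la] [b bT lb] h; apply: (lifts_nocross aT bT la lb); left. Qed.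

Lemma chord_noray (x y z : int) : chord T x y -> ray T z -> ~ x < z < y.
Proof. by move=> [a aT la] [b bT lb]; apply: (lifts_nocross aT bT la lb). Qed.

Lemma side1 (x : int) : side T x (x + 1). Proof. by left. Qed.

(* The rank of [Chord x y] among the chords leaving x; it is 0 on boundary edges. *)
Definition deg_upto (x y : int) : nat :=
  #|[set k : 'I_n.+1 | `[< chord T x (x + (k : nat)%:Z) /\ x + (k : nat)%:Z <= y >]]|.

Lemma deg_upto1 (x : int) : deg_upto x (x + 1) = 0%N.
Proof.
apply/eqP; rewrite cards_eq0; apply/eqP/setP => k; rewrite !inE.
by apply/asboolP => -[/chord_len]; lia.
Qed.

Lemma deg_upto_max (x y : int) :
  (forall w : int, y < w -> ~ chord T x w) -> deg_upto x y = outdeg T x.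
Proof.
move=> h; congr #|pred_of_set _|; apply/setP => k; rewrite !inE.
apply/asboolP/asboolP => [[]//|ch]; split=> //.
by rewrite leNgt; apply/negP => /h.
Qed.

Lemma deg_upto_le (x y : int) : (deg_upto x y <= outdeg T x)%N.
Proof.
apply/subset_leq_card/subsetP => k; rewrite !inE => /asboolP[ch _].
exact/asboolP.
Qed.

Lemma deg_upto_next (x v y : int) : chord T x y -> v < y ->
  (forall w : int, v < w < y -> ~ chord T x w) -> deg_upto x y = (deg_upto x v).+1.
Proof.
move=> ch vy h; have len := chord_len ch.
have kn : (`|y - x| < n.+1)%N by lia.
have e : x + `|y - x|%N%:Z = y by lia.
rewrite /deg_upto (cardsD1 (Ordinal kn)) inE asboolT; last by rewrite /= e.
rewrite add1n; congr (#|pred_of_set _|.+1); apply/setP => k; rewrite !inE.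
apply/andP/asboolP => [[nk /asboolP[chk ky]]|[chk kv]]; last first.
  split; last by apply/asboolP; split=> //; lia.
  by apply/eqP => ek; move: kv; rewrite ek /= e; lia.
split=> //; rewrite leNgt; apply/negP => vk; apply: (h (x + (k : nat)%:Z)) => //.
suff: x + (k : nat)%:Z != y by lia.
by apply: contraNneq nk => ek; apply/eqP/val_inj => /=; lia.
Qed.

(** On a boundary edge, of rank 0, the formula is the recursion [Hdeg]; on the longest chord from
    [x], of full rank, it is a drop by 1. *)
Definition height_spec (x y : int) : Prop :=
  H y = H x + m%:Z * ((outdeg T x)%:Z - (deg_upto x y)%:Z) - 1 /\
  forall z : int, x < z < y -> H y < H z.

(** No chord from a corner passes beyond [y], so the greedy step is the longest side there and has
    full rank. *)
Lemma greedy_unit_drop (x y : int) p :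
  (forall u w : int, x <= u -> w <= y -> side T u w -> height_spec u w) ->
  (forall u w : int, x <= u < y -> y < w -> ~ chord T u w) ->
  path (greedy (side T) y) x p -> path (unit_drop H) x p.
Proof.
elim: p x => [//|v p IH] x hs nc /= /andP[/asboolP[xv vy s_xv gv] pp].
apply/andP; split; last first.
  by apply: IH => // [u w xu wy|u w xu]; [apply: hs; lia|apply: nc; lia].
have [] := hs x v (lexx x) vy s_xv.
rewrite deg_upto_max ?subrr ?mulr0 ?addr0; first by move=> e h; apply/asboolP.
move=> w vw ch; have [wy|yw] := leP w y.
  by apply: (gv w); [lia|right].
by apply: (nc x w) => //; lia.
Qed.

(** Induction on length. The face below a chord from [x] to [y] consists of [x], the end [v] of the
    next shorter side at [x], and a greedy path from [v] to [y]. Having [m + 2] corners, it makes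
    [m] unit drops after [v], while the rank grows by one. *)
Lemma side_height (x y : int) : side T x y -> height_spec x y.
Proof.
move: {2}`|y - x|%N (leqnn `|y - x|%N) => d; elim: d x y => [|d IH] x y.
  move=> d0 [e|/chord_len]; lia.
move=> dxy [->|ch].
  by split; [rewrite deg_upto1 Hdeg PoszM subr0|move=> z; lia].
have len := chord_len ch.
(* The bound [y - 1] excludes the chord itself. *)
have [v gv] := @greedy_step (side T) side1 x (y - 1) ltac:(lia).
have /asboolP[xv vy sv vmax] := gv.
have [p pp lp] := @greedy_path (side T) side1 v y ltac:(lia).
have sz : size p = m.
  have [_ _ bf _] := angT; suff f : bounded_face T [:: x, v & p] by have := bf _ f; rewrite /= addn2 => -[].
  have p0 : (0 < size p)%N by case: (p) lp => //= e; lia.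
  split=> //=; first by rewrite xv (greedy_sorted pp).
  - by move=> [|j] jp //=; apply: greedy_sides pp _.
  - by rewrite nth_last /= lp; right.
  - move=> [|i] [|[|j]] //= ij jp ne; last exact: (greedy_nodiag (i := i) (j := j.+1) pp).
    have jsz : (j < (size p).-1)%N.
      have: j <> (size p).-1 by move=> e; apply: ne; split=> //; lia.
      lia.
    (* Apart from the chord closing the face, a diagonal from [x] would end strictly between [v] and
       [y]. *)
    apply: vmax; have /andP[-> h] : v < nth 0 p j < y by apply: greedy_inner pp lp _; lia.
    by rewrite /= lerBrDr lezD1.
have dp : path (unit_drop H) v p.
  apply: (greedy_unit_drop _ _ pp) => [u w vu wy s_uw|u w vu yw chu].
    have uw : u < w by case: s_uw => [->|/chord_len]; lia.
    by apply: IH => //; lia.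
  by apply: (chord_nocross ch chu); lia.
have [Hl _ hl] := unit_drop_path dp; rewrite lp sz in Hl hl.
have [Hv hv] := IH x v ltac:(lia) sv.
have vy' : v < y by lia.
rewrite /height_spec (deg_upto_next ch vy').
  split; first by rewrite Hl Hv; lia.
  move=> z xz; have [vz|zv] := leP v z; first by apply: hl; lia.
  by have := hv z; lia.
by move=> w vw chw; apply: (vmax w); [lia|right].
Qed.

(** The greedy path from [p] to [q] bounds a face at the puncture, hence has [m] steps; the ray at
    [q] stops chords from passing over it, so each step is a unit drop. *)
Lemma next_ray_height (p q : int) : p < q -> ray T p -> ray T q ->
  (forall z : int, p < z < q -> ~ ray T z) ->
  H q = H p - m%:Z /\ forall z : int, p <= z < q -> H q < H z.
Proof.
move=> pq rp rq nr; have [r pr lr] := @greedy_path (side T) side1 p q (ltW pq).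
have sz : size r = m.
  have [_ _ _ pf] := angT; suff f : punct_face T (p :: r) by have := pf _ f; rewrite /= addn2 => -[].
  have r0 : (0 < size r)%N by case: (r) lr => //= e; lia.
  split=> //=; first by rewrite (greedy_sorted pr).
  - by rewrite nth_last /= lr.
  - by move=> j jp; apply: greedy_sides pr _.
  - by move=> [//|j] _ jp; apply: nr => /=; apply: greedy_inner pr lr _.
  - by move=> i j ij jp; apply: greedy_nodiag pr _ _.
have dr : path (unit_drop H) p r.
  apply: (greedy_unit_drop _ _ pr) => [u w _ _ /side_height//|u w pu qw chu].
  have [e|pu'] := eqVneq p u; last by apply: (chord_noray chu rq); lia.
  by apply: (chord_noray chu rq); lia.
by have [Hl _ hl] := unit_drop_path dr; rewrite lr sz in Hl hl.
Qed.

Lemma prev_ray (x : int) :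
  exists p : int, [/\ p <= x, ray T p & forall z : int, p < z <= x -> ~ ray T z].
Proof.
have [p0 rp0] : exists p, ray T p.
  have [_ [[i|//] iT _] _ _] := angT.
  exists (i : nat)%:Z; exists (inl i); rewrite //= modz_small //.
  by have := ltn_ord i; lia.
have ex : exists d : nat, `[< ray T (x - d%:Z) >].
  have r0 : 0 <= ((x - p0) %% n)%Z by apply: modz_ge0; lia.
  (* This is the distance from [x] back to the last translate of [p0] not beyond [x]. *)
  exists `|((x - p0) %% n)%Z|%N; apply/asboolP.
  have := ray_shift ((x - p0) %/ n)%Z rp0.
  have e := divz_eq (x - p0) n.
  by rewrite (_ : p0 + _ = x - `|((x - p0) %% n)%Z|%N%:Z) //; lia.
case: (ex_minnP ex) => d /asboolP rd dmin; exists (x - d%:Z); split=> //; first by lia.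
move=> z zx rz; have e : z = x - `|x - z|%N%:Z by lia.
by have := dmin `|x - z|%N; rewrite -e asboolT // => /(_ isT); lia.
Qed.

Lemma next_ray (x : int) :
  exists q : int, [/\ x < q, ray T q & forall z : int, x < z < q -> ~ ray T z].
Proof.
have [p [px rp _]] := prev_ray x.
have ex : exists d : nat, `[< ray T (x + d.+1%:Z) >].
  have r0 : 0 <= ((x - p) %% n)%Z by apply: modz_ge0; lia.
  have rn : ((x - p) %% n)%Z < n%:Z by apply: ltz_pmod; lia.
  have e := divz_eq (x - p) n.
  (* The first translate of [p] beyond [x]; the final [- 1] compensates for the offset [d.+1]. *)
  pose d := n%:Z - ((x - p) %% n)%Z - 1; exists (absz d); apply/asboolP.
  have := ray_shift (((x - p) %/ n)%Z + 1) rp.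
  by rewrite (_ : p + _ = x + (absz d).+1%:Z) // /d; lia.
case: (ex_minnP ex) => d /asboolP rd dmin; exists (x + d.+1%:Z); split=> //; first by lia.
move=> z zx rz; have e : z = x + `|(z - x - 1)%R|%N.+1%:Z by lia.
by have := dmin `|(z - x - 1)%R|%N; rewrite -e asboolT // => /(_ isT); lia.
Qed.

(** Walk left from [p] ray by ray: each gap is controlled by [next_ray_height] and contributes
    exactly [m]. *)
Lemma ray_record_low (p z : int) : ray T p -> z < p ->
  H p < H z /\ (ray T z -> (m %| H z - H p)%Z).
Proof.
move: {2}`|p - z|%N (leqnn `|p - z|%N) => d; elim: d p => [|d IH] p dp rp zp.
  by lia.
have [q [qp rq nr]] := prev_ray (p - 1).
have [|w qw|e h] := @next_ray_height q p _ rq rp; [lia|by apply: nr; lia|].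
have [qz|zq|ezq] := ltgtP q z.
- by split=> [|rz]; [apply: h; lia|case: (nr z); [lia|]].
- have [|h1 h2] := IH q _ rq zq; first by lia.
  split=> [|/h2 d1]; first by lia.
  have d2 : (m %| m%:Z)%Z by apply: dvdzz.
  by apply: (dvdz_addsub d1 d2); right; lia.
- split=> [|_]; first by apply: h; lia.
  by rewrite -ezq e opprB addrC subrK dvdzz.
Qed.

(* Between consecutive rays p < q the height of a record low lies strictly
   between H p - m and H p, so it cannot be congruent to H p modulo m. *)
Lemma record_low_ray (x r : int) : ray T r -> (m %| H x - H r)%Z ->
  (forall z : int, z < x -> H x < H z) -> ray T x.
Proof.
move=> rr d lx; have [p [px rp np]] := prev_ray x.
have [<-//|nxp] := eqVneq p x.
have [q [xq rq nq]] := next_ray x.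
have [|z pz rz|e h] := @next_ray_height p q _ rp rq; first by lia.
  by have [zx|xz] := leP z x; [apply: (np z)|apply: (nq z)] => //; lia.
have drp : (m %| H r - H p)%Z.
  have [rp'|pr'|->] := ltgtP r p; last by rewrite subrr dvdz0.
    by have [_] := ray_record_low rp rp'; apply.
  have [_ /(_ rp) d1] := ray_record_low rr pr'.
  by apply: (dvdz_addsub (dvdz0 m) d1); left; lia.
have /dvdzP[k ek] := dvdz_addsub d drp (or_intror erefl).
have h1 := lx p ltac:(lia); have h2 := h x ltac:(lia).
by exfalso; have [k0|k0] := leP 0 k; nia.
Qed.

Variable s : nat.
Hypotheses (s_gt0 : (0 < s)%N) (m_dvd_n : (m %| n)%N).
Hypothesis Hmod : forall x : int, (m %| H x + x)%Z.
Hypothesis Hper : forall x : int, H (x + n%:Z) = H x - (m * s)%N%:Z.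

Lemma Hdeg_step (x : int) : H x - 1 <= H (x + 1). Proof. by rewrite Hdeg; lia. Qed.

Lemma side_chordH (x y : int) : side T x y -> height_chord m H x y.
Proof.
move=> sxy; have [Hy hz] := side_height sxy; have le := deg_upto_le x y.
split=> //; first by case: sxy => [->|/chord_len]; lia.
  by rewrite Hy; nia.
have d1 := dvdz_addsub (Hmod y) (Hmod x) (or_introl erefl).
have d2 : (m %| m%:Z * ((outdeg T x)%:Z - (deg_upto x y)%:Z))%Z by apply: dvdz_mulr.
by apply: (dvdz_addsub d1 d2); left; lia.
Qed.

(** Any ray supplies the residue [c]. Every chord of [T] is a height chord, and both families have
    the same finite outdegree at each point, so the inclusion is an equality. *)
Lemma angulation_eq_height_arcs : exists2 c, (c < m)%N & T = height_arcs m n H c.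
Proof.
have [r [_ rr _]] := prev_ray 0.
have r0 : 0 <= (r %% m)%Z by apply: modz_ge0; lia.
have rm : (r %% m)%Z < m%:Z by apply: ltz_pmod; lia.
exists `|(r %% m)%Z|%N; first by lia.
set c := `|_|%N; have dr : (m %| r - c%:Z)%Z.
  have -> : c%:Z = (r %% m)%Z by lia.
  by rewrite {1}(divz_eq r m) addrK dvdz_mull.
have HdvdE := dvd_height Hmod.
have rayE (x : int) : ray T x <-> record_low H x /\ (m %| x - c%:Z)%Z.
  split=> [rx|[lx dx]].
    split=> [z zx|]; first by have [] := ray_record_low rx zx.
    have d1 : (m %| x - r)%Z.
      have [xr|rx'|->] := ltgtP x r; last by rewrite subrr dvdz0.
        have [_ /(_ rx)] := ray_record_low rr xr; rewrite HdvdE => d1.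
        by apply: (dvdz_addsub (dvdz0 m) d1); left; lia.
      by have [_ /(_ rr)] := ray_record_low rx rx'; rewrite HdvdE.
    by apply: (dvdz_addsub d1 dr); right; lia.
  apply: (record_low_ray rr) => //; rewrite HdvdE.
  by apply: (dvdz_addsub dr dx); left; lia.
apply: (eq_parc_set n_gt0) => [x|x y].
  rewrite rayE; by split=> h; apply/(ray_height_arcs m_gt0 n_gt0 s_gt0 m_dvd_n Hper).
have sideE := side_height_arcs m_gt0 n_gt0 s_gt0 m_dvd_n Hdeg_step Hper c.
have sub u v : chord T u v -> chord (height_arcs m n H c) u v.
  move=> ch; have [e|//] : side (height_arcs m n H c) u v.
    by apply/sideE/side_chordH; right.
  by have := chord_len ch; lia.
split=> [|ch]; first exact: sub.
have len := chord_len ch; have kn : (`|y - x| < n.+1)%N by lia.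
have e : x + `|y - x|%N%:Z = y by lia.
have := outdeg_height_arcs m_gt0 n_gt0 s_gt0 m_dvd_n Hdeg_step Hmod Hper c (Hdeg x).
rewrite /outdeg => card_eq.
set A := [set k | _] in card_eq; set B := [set k | _] in card_eq.
have BA : B \subset A by apply/subsetP => k; rewrite !inE => /asboolP/sub ?; apply/asboolP.
have /eqP AB : B == A by rewrite eqEcard BA card_eq /=.
have : Ordinal kn \in B by rewrite AB inE; apply/asboolP; rewrite /= e.
by rewrite inE => /asboolP; rewrite /= e.
Qed.

End Angulation.

(** * The height function of a degree sequence *)

(** Closed form of the solution of the recursion that vanishes at 0: whole periods contribute full
    sums, the remainder a partial sum. *)
Definition height (m n : nat) (a : nat -> nat) (x : int) : int :=
  m%:Z * ((x %/ n)%Z * (\sum_(0 <= i < n) a i)%N%:Z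
          + (\sum_(0 <= i < `|(x %% n)%Z|) a i)%N%:Z) - x.

Section Height.
Variables (m n : nat) (a : nat -> nat).
Hypothesis n_gt0 : (0 < n)%N.

Lemma heightE (q : int) (r : nat) : (r < n)%N ->
  height m n a (q * n%:Z + r%:Z) =
  m%:Z * (q * (\sum_(0 <= i < n) a i)%N%:Z + (\sum_(0 <= i < r) a i)%N%:Z)
  - (q * n%:Z + r%:Z).
Proof.
move=> rn; rewrite /height modzMDl divzMDl; last by lia.
by rewrite modz_small ?divz_small ?addr0 //; lia.
Qed.

Lemma height_step (x : int) :
  height m n a (x + 1) = height m n a x + (m * a `|(x %% n)%Z|)%N%:Z - 1.
Proof.
have r0 : 0 <= (x %% n)%Z by apply: modz_ge0; lia.
have rn : (x %% n)%Z < n%:Z by apply: ltz_pmod; lia.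
have e := divz_eq x n; move: e r0 rn; set q := (x %/ n)%Z.
case: (x %% n)%Z => [r|//] e _ rn; rewrite e heightE /=; last by lia.
have [rn'|rn'] := ltnP r.+1 n.
  have -> : q * n%:Z + r%:Z + 1 = q * n%:Z + r.+1%:Z by lia.
  by rewrite heightE // big_nat_recr //= PoszD !PoszM intS; ring.
have en : n = r.+1 by lia.
have enz : n%:Z = r%:Z + 1 by lia.
have eS : (\sum_(0 <= i < n) a i = \sum_(0 <= i < r) a i + a r)%N.
  by rewrite en big_nat_recr.
have -> : q * n%:Z + r%:Z + 1 = (q + 1) * n%:Z + 0%N%:Z by rewrite enz; ring.
have e0 : (\sum_(0 <= i < 0) a i = 0)%N by rewrite big_geq.
by rewrite heightE // e0 eS enz PoszD PoszM; ring.
Qed.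

Lemma height_period (x : int) :
  height m n a (x + n%:Z) = height m n a x + m%:Z * (\sum_(0 <= i < n) a i)%N%:Z - n%:Z.
Proof.
have n0 : n%:Z != 0 by lia.
by rewrite /height modzDr divzDr ?dvdzz // divzz n0 /=; ring.
Qed.

Lemma height_dvd (x : int) : (m %| height m n a x + x)%Z.
Proof. by rewrite /height subrK dvdz_mulr. Qed.

End Height.

Lemma eq_height (m n : nat) (a b : nat -> nat) : (0 < n)%N ->
  (forall i, (i < n)%N -> a i = b i) -> height m n a = height m n b.
Proof.
move=> n0 ab; apply/funext => x; rewrite /height.
have r0 : 0 <= (x %% n)%Z by apply: modz_ge0; lia.
have rn : (x %% n)%Z < n%:Z by apply: ltz_pmod; lia.
congr (_ * (_ * _%:Z + _%:Z) - _); apply: eq_big_nat => i ri; apply: ab; lia.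
Qed.

(** * Counting degree sequences and residues *)

Lemma outdeg_mod n (T : {set parc n}) (x : int) : (0 < n)%N ->
  outdeg T `|(x %% n)%Z|%N%:Z = outdeg T x.
Proof.
move=> n0; have r0 : 0 <= (x %% n)%Z by apply: modz_ge0; lia.
have -> : `|(x %% n)%Z|%N%:Z = (x %% n)%Z by lia.
have e := divz_eq x n; congr #|pred_of_set _|; apply/setP => k; rewrite !inE.
apply/asboolP/asboolP => ch.
  have := chord_shift (x %/ n)%Z ch.
  rewrite (_ : (x %% n)%Z + _ = x); last by lia.
  by rewrite (_ : (x %% n)%Z + _ + _ = x + (k : nat)%:Z) //; lia.
have := chord_shift (- (x %/ n)%Z) ch.
rewrite (_ : x + _ = (x %% n)%Z); last by lia.
by rewrite (_ : x + _ + _ = (x %% n)%Z + (k : nat)%:Z) //; lia.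
Qed.

(** Pairs of a sequence of [n + 1] degrees with sum [l - s] and a residue modulo [m] are mapped
    bijectively to angulations by [f]; the sequences are counted by [card_ord_partitions]. *)
Lemma card_angulations (m l s n : nat) : (0 < m)%N -> (0 < s <= l)%N -> n.+1 = (m * l)%N ->
  #|[set T : {set parc n.+1} | `[< angulation m T /\ nspokes T = s >] ]| =
  (m * 'C(n + (l - s), n))%N.
Proof.
move=> m0 /andP[s0 sl] nml; set t := (l - s)%N.
have mdn : (m %| n.+1)%N by rewrite nml dvdn_mulr.
pose a (u : n.+1.-tuple 'I_t.+1) (i : nat) : nat := nth 0%N (map val u) i.
have aE u (i : 'I_n.+1) : a u i = tnth u i.
  by rewrite /a (nth_map ord0) ?size_tuple // (tnth_nth ord0).
have asum u : (\sum_(0 <= i < n.+1) a u i = \sum_(i <- u) i)%N.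
  transitivity (\sum_(j <- map val u) j)%N; last by rewrite big_map.
  by rewrite [RHS](big_nth 0%N) size_map size_tuple.
pose ht u := height m n.+1 (a u).
have hstep u (x : int) : ht u (x + 1) = ht u x + (m * a u `|(x %% n.+1)%Z|)%N%:Z - 1.
  exact: height_step.
have Hstep u (x : int) : ht u x - 1 <= ht u (x + 1) by rewrite hstep; lia.
have Hmod u (x : int) : (m %| ht u x + x)%Z by apply: height_dvd.
pose A := [set u : n.+1.-tuple 'I_t.+1 | \sum_(i <- u) i == t]%N.
have Hper u (x : int) : u \in A -> ht u (x + n.+1%:Z) = ht u x - (m * s)%N%:Z.
  rewrite inE => /eqP su; rewrite /ht height_period // asum su nml.
  have -> : l = (t + s)%N by rewrite subnK.
  by rewrite mulnDr PoszD !PoszM; ring.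
pose f (uc : n.+1.-tuple 'I_t.+1 * 'I_m) := height_arcs m n.+1 (ht uc.1) uc.2.
transitivity #|f @: setX A [set: 'I_m]|; last first.
  rewrite card_in_imset ?cardsX ?cardsT ?card_ord ?card_ord_partitions 1?mulnC //.
  move=> [u c] [u' c']; rewrite !inE /= !andbT => uA uA' /= ef.
  have {}uA : u \in A by rewrite inE.
  have {}uA' : u' \in A by rewrite inE.
  (* The degrees are recovered as outdegrees, and then the residue from the position of any ray. *)
  have eu : u = u'.
    apply: eq_from_tnth => i; suff : a u i = a u' i by rewrite !aE; apply: val_inj.
    have out v (vA : v \in A) c0 :=
      outdeg_height_arcs m0 (ltn0Sn n) s0 mdn (Hstep v) (Hmod v) (fun x => Hper v x vA) c0
        (hstep v (i : nat)%:Z).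
    have := out u uA c; rewrite [height_arcs _ _ _ _]ef out //= modz_small //.
    by have := ltn_ord i; lia.
  rewrite -{u' uA'}eu in ef *; congr (_, _).
  have HperA x := Hper u x uA.
  have rayE c0 x := ray_height_arcs m0 (ltn0Sn n) s0 mdn HperA c0 x.
  have [_ [[i|//] iT _] _ _] := angulation_height_arcs m0 (ltn0Sn n) s0 mdn (Hstep u) (Hmod u) HperA c.
  have ri : ray (f (u, c)) (i : nat)%:Z.
    by exists (inl i); rewrite //= modz_small //; have := ltn_ord i; lia.
  have /rayE[_ d] := ri; have := ri; rewrite ef => /rayE[_ d'].
  have /dvdzP[k] := dvdz_addsub d d' (or_introl erefl).
  rewrite /= => ek; apply: val_inj => /=; have := ltn_ord c; have := ltn_ord c' => c'm cm.
  have k0 : k = 0 by have [||//] := ltgtP k 0; nia.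
  by rewrite k0 mul0r in ek; lia.
apply: eq_card => T; rewrite inE; apply/asboolP/imsetP => [[angT spT]|]; last first.
  move=> [[u c]]; rewrite inE => /andP[uA _] ->.
  have HperA x := Hper u x uA.
  split; first exact: (angulation_height_arcs m0 (ltn0Sn n) s0 mdn (Hstep u) (Hmod u) HperA c).
  exact: (nspokes_height_arcs m0 (ltn0Sn n) s0 mdn (Hstep u) (Hmod u) HperA c).
pose b i := outdeg T (i : nat)%:Z; pose H := height m n.+1 b.
have Hdeg (x : int) : H (x + 1) = H x + (m * outdeg T x)%N%:Z - 1.
  by rewrite /H height_step // /b outdeg_mod.
have nmz : n.+1%:Z = m%:Z * l%:Z by rewrite nml PoszM.
(* A ray and its translate by one period are both rays, so the height strictly drops over a
   period. *)
have bl : (\sum_(0 <= i < n.+1) b i < l)%N.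
  have [r [_ rr _]] := prev_ray m0 (ltn0Sn n) angT 0.
  have rr' := ray_shift 1 rr; rewrite mul1r in rr'.
  have rlt : r < r + n.+1%:Z by lia.
  have [+ _] := ray_record_low m0 (ltn0Sn n) angT Hdeg rr' rlt.
  by rewrite /H height_period // nmz -addrA gtrDl subr_lt0 -PoszM ltz_nat ltn_pmul2l.
have HperT (x : int) : H (x + n.+1%:Z) = H x - (m * (l - \sum_(0 <= i < n.+1) b i))%N%:Z.
  rewrite /H height_period // nmz -{1}(subnK (ltnW bl)) !PoszM PoszD; ring.
have HmodT (x : int) : (m %| H x + x)%Z by apply: height_dvd.
have s'0 : (0 < l - \sum_(0 <= i < n.+1) b i)%N by rewrite subn_gt0.
have [c cm eT] := angulation_eq_height_arcs m0 (ltn0Sn n) angT Hdeg s'0 mdn HmodT HperT.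
have HstepT (x : int) : H x - 1 <= H (x + 1) by rewrite Hdeg; lia.
have := nspokes_height_arcs m0 (ltn0Sn n) s'0 mdn HstepT HmodT HperT c.
rewrite -eT spT => es.
(* The spoke count found from the height is [l] minus the degree sum, and it must equal [s]. *)
have bt : (\sum_(0 <= i < n.+1) b i = t)%N by rewrite /t; lia.
have b_le i : (i < n.+1)%N -> (b i <= t)%N.
  move=> ni; rewrite -bt big_mkord (bigD1 (Ordinal ni)) //=; lia.
pose u := [tuple inord (b i) : 'I_t.+1 | i < n.+1].
have au i : (i < n.+1)%N -> a u i = b i.
  move=> ni; have := aE u (Ordinal ni); rewrite /= => ->.
  by rewrite tnth_mktuple inordK // ltnS b_le.
have uA : u \in A.
  rewrite inE -asum -[X in _ == X]bt; apply/eqP; apply: eq_big_nat => i /andP[_]; exact: au.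
exists (u, Ordinal cm); first by rewrite inE uA inE.
by rewrite /f /= /ht (eq_height m (ltn0Sn n) au).
Qed.

Local Close Scope ring_scope.

Theorem theorem3p4 (m l s : nat) :
  (1 <= m)%N -> (1 <= l)%N -> (1 <= s <= l)%N ->
  #|[set T : {set parc (m * l)} | `[< angulation m T /\ nspokes T = s >] ]| =
  (m * 'C(m * l + l - s - 1, m * l - 1))%N.
Proof.
move=> m0 l0 sl; have : (0 < m * l)%N by rewrite muln_gt0 m0.
move En : (m * l)%N => n; case: n En => [//|n] /esym En _.
rewrite (card_angulations m0 sl En) subn1 /= -addnBA; last by case/andP: sl.
by rewrite addSn subn1.
Qed.
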